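(* For every real number $a>\frac14$ there exists a real sequence $(a_i)_{i\ge 1}$ with $a_i\to a$ as $i\to\infty$ such that the continued fraction $$\frac{-a_1}{1-\frac{a_2}{1-\frac{a_3}{1-\dots}}}$$ converges.
   Context: For any $b\in\mathbb R$ put $T_b(z)=-\frac{b}{z+1}$. The $n$-th subsequent ratio (approximant) $p_n/q_n$ of the continued fraction with real coefficients $a_1,a_2,\dots$ is $$\tau_n=T_{a_1}\circ T_{a_2}\circ\dots\circ T_{a_n}(0)\in\mathbb R\cup\{\infty\}.$$ The continued fraction converges if the sequence $(\tau_n)_{n\ge1}$ converges in $\mathbb R\cup\{\infty\}$, the boundary $\partial H$ of the closed upper half-plane $H=\{\operatorname{Im} z\ge 0\}\cup\{\infty\}$ in the Riemann sphere. *)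

(* Defs.v *)
From HB Require Import structures.
From mathcomp Require Import all_boot all_order all_algebra.
From mathcomp Require Import all_classical all_reals all_analysis.

Set Implicit Arguments.
Unset Strict Implicit.
Unset Printing Implicit Defensive.

Import Order.TTheory GRing.Theory Num.Theory.
Import numFieldNormedType.Exports.

Local Open Scope classical_set_scope.
Local Open Scope ring_scope.

(* The boundary circle R u {oo} of the upper half-plane, with the topology
   induced by the Riemann sphere; the point at infinity is [None]. *)
Definition boundary (R : realType) : topologicalType :=
  one_point_compactification R.

(* T_b(z) = - b / (z + 1), so that T_b(-1) = oo and T_b(oo) = 0. For b = 0 the
   formula reads 0 / 0 at z = -1; the value chosen there is a mere convention. *)
Definition Tmap (R : realType) (b : R) (z : boundary R) : boundary R :=
  match z with
  | Some x => if x == - 1 then None else Some (- (b / (x + 1)))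
  | None => Some 0
  end.

(* tau_n = (T_{a_1} o ... o T_{a_n})(0); the value [a 0%N] is not used. *)
Definition approximant (R : realType) (a : nat -> R) (n : nat) : boundary R :=
  foldr (fun i z => Tmap (a i) z) (Some 0) (iota 1 n).

Definition cfrac_converges (R : realType) (a : nat -> R) : Prop :=
  exists l : boundary R, approximant a n @[n --> \oo] --> l.

(* Main.v *)
(* Write p_n/q_n = tau_n and r_n = q_n/q_{n-1}, so that r_{n+1} = 1 - a_{n+1}/r_n
   and tau_{n+1} - tau_n = ((1 - r_{n+1})/r_{n+1}) (tau_n - tau_{n-1}). For the
   constant sequence a the map T_a is elliptic, with a fixed point zeta in the
   upper half-plane, and the image of zeta under T_{a_1} o ... o T_{a_n} has real
   part
     c_n = tau_n + (tau_n - tau_{n-1}) (r_n/2 - a)/f(r_n),  f(x) = x^2 - x + a,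
   which moves only when a_n differs from a. Take a_{n+1} = a/t_n, where t_n is
   within O(n^(-1/2)) of 1. The weight
     V_n = r_n (tau_n - tau_{n-1})/f(r_n)
   is then divided by f(t_n r_n)/(t_n f(r_n)), that is by
     1 + (t_n - 1)(r_n^2 - a/t_n)/f(r_n).
   If the sign of t_n - 1 is that of r_n^2 - a, this factor is at least 1 + C/n
   with C as large as desired, so that V_n = O(n^-2). The increments of c_n
   are O(V_n), so c_n converges. Two admissible sizes for t_n - 1 are available
   at each step, and one of them keeps |r_{n+1}| above a multiple of n^(-1/2);
   hence tau_n - c_n = V_n (a/r_n - 1/2) tends to 0. *)
Require Import Defs.
From HB Require Import structures.
From mathcomp Require Import all_boot all_order all_algebra.
From mathcomp Require Import all_classical all_reals all_analysis.
From mathcomp Require Import ring lra.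

Set Implicit Arguments.
Unset Strict Implicit.
Unset Printing Implicit Defensive.

Import Order.TTheory GRing.Theory Num.Theory.
Import numFieldNormedType.Exports.

Local Open Scope classical_set_scope.
Local Open Scope ring_scope.

(** * Bounds on the quadratic f *)

(* Its roots are the opposites of the fixed points of T_a. *)
Definition fixpoly (R : realFieldType) (a x : R) : R := x ^+ 2 - x + a.

Lemma fixpoly_ge (R : realFieldType) (a : R) (ha : 1 / 4 < a) :
  exists2 c : R, 0 < c & forall x, c * (x ^+ 2 + 1) <= fixpoly a x.
Proof.
(* The form x^2 - xy + a y^2 has determinant a - 1/4 and trace 1 + a; their quotient is at most its
   smaller eigenvalue. *)
exists ((4 * a - 1) / (4 * (1 + a))); first by apply: divr_gt0; lra.
move=> x; rewrite mulrAC ler_pdivrMr /fixpoly; last by lra.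
rewrite -subr_ge0.
have -> : (x ^+ 2 - x + a) * (4 * (1 + a)) - (4 * a - 1) * (x ^+ 2 + 1) =
  (5 * x ^+ 2 - 4 * (1 + a) * x) + (4 * a ^+ 2 + 1) by ring.
have := sqr_ge0 (5 * x - 2 * (1 + a)); have := sqr_ge0 (4 * a - 1); nra.
Qed.

Lemma fixpoly_gt0 (R : realFieldType) (a x : R) : 1 / 4 < a -> 0 < fixpoly a x.
Proof. by move=> ha; have := sqr_ge0 (2 * x - 1); rewrite /fixpoly; nra. Qed.

Lemma fixpoly_le (R : realFieldType) (a x : R) :
  1 / 4 < a -> fixpoly a x <= 2 * (x ^+ 2 + a).
Proof. by move=> ha; have := sqr_ge0 (2 * x + 1); rewrite /fixpoly; nra. Qed.

(** * Choice of the perturbation t *)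

(** The sign of t - 1 turns the product into d |x^2 - a| + a d^2 / t. The second term preserves a
    gain of order e^2 even where x^2 is close to a. *)
Lemma perturbation_gain (R : realFieldType) (a e d x : R) :
    1 / 4 < a -> 0 < e <= 1 / 4 -> (d == e) || (d == 2 * e) ->
  let t := if a <= x ^+ 2 then 1 + d else 1 - d in
  e ^+ 2 * fixpoly a x / 6 <= (t - 1) * (x ^+ 2 - a / t).
Proof.
move=> ha /andP[e0 e1] hd; set t := if _ then _ else _.
have [d0 d1] : e <= d /\ d <= 1 / 2 by case/orP: hd => /eqP ->; split; lra.
apply: (@le_trans _ _ (e ^+ 2 * (x ^+ 2 + a) / 3)).
  have := fixpoly_le x ha; have := sqr_ge0 e; nra.
have e2 : e ^+ 2 <= d ^+ 2 by rewrite ler_sqr ?nnegrE; lra.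
have ae : a * e ^+ 2 <= a * d ^+ 2 by rewrite ler_wpM2l; lra.
have ae0 : 0 <= a * e ^+ 2 by rewrite mulr_ge0 ?sqr_ge0; lra.
have [ed e2d] : e ^+ 2 <= d /\ 0 <= e ^+ 2 by split; nra.
rewrite /t; case: ifPn => [hx|]; last rewrite -ltNge => hx.
- have -> : (1 + d - 1) * (x ^+ 2 - a / (1 + d)) =
     d * (x ^+ 2 - a) + a * d ^+ 2 / (1 + d) by field; lra.
  have : e ^+ 2 * a * (2 / 3) <= a * d ^+ 2 / (1 + d).
    by rewrite ler_pdivlMr; [have := mulr_ge0 ae0 (_ : 0 <= 1 / 2 - d); nra|lra].
  have := sqr_ge0 e; nra.
- have -> : (1 - d - 1) * (x ^+ 2 - a / (1 - d)) =
     d * (a - x ^+ 2) + a * d ^+ 2 / (1 - d) by field; lra.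
  have : e ^+ 2 * a <= a * d ^+ 2 / (1 - d).
    by rewrite ler_pdivlMr; nra.
  have := sqr_ge0 e; have := sqr_ge0 x; nra.
Qed.

(** For t x nonzero the last bound reads |1 - a/(t x)| >= e/8, which keeps the next ratio away from
    0. The candidates d = e and d = 2e give values of t x that are e |x| apart; if both failed,
    these values would be less than 3 e |x| / 8 apart. *)
Lemma perturbation_exists (R : realFieldType) (a e x : R) :
    1 / 4 < a -> 0 < e <= 1 / 4 ->
  exists t, [/\ `|t - 1| <= 2 * e,
    e ^+ 2 * fixpoly a x / 6 <= (t - 1) * (x ^+ 2 - a / t)
    & e / 8 * `|t * x| <= `|t * x - a|].
Proof.
move=> ha he; have /andP[e0 e1] := he.
pose t (d : R) := if a <= x ^+ 2 then 1 + d else 1 - d.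
have tE d : 0 <= d -> `|t d - 1| = d.
  by move=> d0; rewrite /t; case: ifP => _; [rewrite ger0_norm|rewrite ler0_norm]; lra.
have tn : `|t e| + `|t (2 * e)| <= 3.
  by rewrite /t; case: ifP => _; rewrite !ger0_norm; lra.
have td : `|t e - t (2 * e)| = e.
  by rewrite /t; case: ifP => _; [rewrite ler0_norm|rewrite ger0_norm]; lra.
have [h|h] := leP (e / 8 * `|t e * x|) `|t e * x - a|.
  exists (t e); split=> //; first by rewrite tE; lra.
  by apply: (@perturbation_gain _ a e); rewrite ?eqxx.
have [h'|h'] := leP (e / 8 * `|t (2 * e) * x|) `|t (2 * e) * x - a|.
  exists (t (2 * e)); split=> //; first by rewrite tE; lra.
  by apply: (@perturbation_gain _ a e); rewrite ?eqxx ?orbT.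
have nx : 0 < `|x|.
  rewrite normr_gt0; apply/eqP => x0.
  by move: h; rewrite x0 mulr0 normr0 mulr0 ltNge normr_ge0.
have := ler_distD a (t e * x) (t (2 * e) * x).
have ex : 0 <= e * `|x| by rewrite mulr_ge0; lra.
have := mulr_ge0 ex (_ : 0 <= 3 - (`|t e| + `|t (2 * e)|)).
rewrite -mulrBl !normrM td (distrC a); rewrite !normrM in h h'.
have exp : 0 < e * `|x| by rewrite mulr_gt0.
by move=> h1 h2; have := h1 ltac:(lra); nra.
Qed.

(** * One step of the weight and of the centre *)

(** The map s -> 1 - a/s fixes the roots of f and has derivative a/s^2: it preserves the vector
    field f(s) d/ds. *)
Lemma fixpoly_image (R : realFieldType) (a s : R) :
  s != 0 -> fixpoly a (1 - a / s) = a * fixpoly a s / s ^+ 2.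
Proof. by move=> s0; rewrite /fixpoly; field. Qed.

Lemma weight_step (R : realFieldType) (a t x D : R) :
    1 / 4 < a -> t != 0 -> x != 0 -> 1 - a / (t * x) != 0 ->
  let x' := 1 - a / (t * x) in
  x' * ((1 - x') / x' * D) / fixpoly a x' =
  x * D / fixpoly a x * (t * fixpoly a x / fixpoly a (t * x)).
Proof.
move=> ha t0 x0 x1 /=.
have s0 : t * x != 0 by rewrite mulf_neq0.
rewrite fixpoly_image //.
have f0 := lt0r_neq0 (fixpoly_gt0 x ha).
have f1 := lt0r_neq0 (fixpoly_gt0 (t * x) ha).
have a0 : a != 0 by rewrite gt_eqF; lra.
set x' := 1 - a / _ in x1 *; have -> : 1 - x' = a / (t * x) by rewrite /x' subKr.
by field; rewrite x0 t0 f0 f1 a0 x1.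
Qed.

(** With D and D' consecutive differences of tau, the left-hand side is the increment of c_n; it
    vanishes at t = 1. *)
Lemma center_step (R : realFieldType) (a t x D : R) :
    1 / 4 < a -> t != 0 -> x != 0 -> 1 - a / (t * x) != 0 ->
  let x' := 1 - a / (t * x) in let D' := (1 - x') / x' * D in
  D' + D' * (x' / 2 - a) / fixpoly a x' - D * (x / 2 - a) / fixpoly a x =
  x * D / fixpoly a x * (t - 1) *
    (a * (t * x + x) - t * x * x / 2 - a / 2) / fixpoly a (t * x).
Proof.
move=> ha t0 x0 x1 /=.
have s0 : t * x != 0 by rewrite mulf_neq0.
rewrite fixpoly_image //.
have f0 := lt0r_neq0 (fixpoly_gt0 x ha).
have f1 := lt0r_neq0 (fixpoly_gt0 (t * x) ha).
have a0 : a != 0 by rewrite gt_eqF; lra.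
move: f0 f1; rewrite /fixpoly => f0 f1.
have x2 : t * x - a != 0.
  by apply: contra x1; rewrite subr_eq0 => /eqP h; rewrite -{1}h divff // subrr.
by field; rewrite x0 t0 f0 f1 a0 x2.
Qed.

(** In s = t x, with 1/t <= 2, the numerator is at most quadratic, while [fixpoly_ge] bounds the
    denominator below by a multiple of s^2 + 1. *)
Lemma center_step_bound (R : realFieldType) (a : R) : 1 / 4 < a ->
  exists2 C, 0 < C & forall t x, `|t - 1| <= 1 / 2 ->
  `|(a * (t * x + x) - t * x * x / 2 - a / 2) / fixpoly a (t * x)| <= C.
Proof.
move=> ha; have [c c0 hc] := fixpoly_ge ha.
exists ((1 + 2 * a) / c); first by apply: divr_gt0; lra.
move=> t x; rewrite ler_norml => /andP[t1 t2].
have f0 := fixpoly_gt0 (t * x) ha.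
rewrite normrM normfV (gtr0_norm f0) ler_pdivrMr // [leRHS]mulrAC ler_pdivlMr //.
apply: (@le_trans _ _ ((1 + 2 * a) * (c * ((t * x) ^+ 2 + 1)))); last first.
  by rewrite ler_wpM2l //; lra.
rewrite [leRHS]mulrCA [leLHS]mulrC ler_pM2l //.
have tx : x = t^-1 * (t * x) by rewrite mulKf // gt_eqF; lra.
rewrite {2 4}tx; have : 0 <= t^-1 <= 2.
  by rewrite invr_ge0 -div1r ler_pdivrMr; lra.
set s := t * x; move: (t^-1) => r /andP[r0 r2].
have s2 := sqr_ge0 s.
have hs : (1 + r) * `|s| <= 3 / 2 * (s ^+ 2 + 1).
  have := sqr_ge0 (`|s| - 1); have := normr_ge0 s; rewrite -(real_normK (num_real s)); nra.
have {}hs : - (3 / 2 * (s ^+ 2 + 1)) <= (1 + r) * s <= 3 / 2 * (s ^+ 2 + 1).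
  by rewrite -ler_norml normrM ger0_norm //; lra.
have p1 : r * s ^+ 2 <= 2 * s ^+ 2 by rewrite ler_wpM2r.
have p0 : 0 <= r * s ^+ 2 by rewrite mulr_ge0.
have -> : a * (s + r * s) - s * (r * s) / 2 - a / 2 =
  a * ((1 + r) * s) - r * s ^+ 2 / 2 - a / 2 by field.
case/andP: hs => h1 h2; rewrite ler_norml.
have q1 : 0 <= a * (3 / 2 * (s ^+ 2 + 1) - (1 + r) * s) by rewrite mulr_ge0; lra.
have q2 : 0 <= a * (3 / 2 * (s ^+ 2 + 1) + (1 + r) * s) by rewrite mulr_ge0; lra.
have q3 : 0 <= a * s ^+ 2 by rewrite mulr_ge0 //; lra.
apply/andP; split; lra.
Qed.

(** * Summable increments, and the composition of the maps T_b *)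

(** As 1/m^2 <= 2 (1/m - 1/(m+1)), subtracting or adding 2K/(k+1) makes c nondecreasing or
    nonincreasing. *)
Lemma cvg_of_increments_le (R : realType) (c : nat -> R) (K : R) :
  (forall k, `|c k.+1 - c k| <= K * k.+1%:R ^-2) -> cvgn c.
Proof.
move=> hc; have K0 : 0 <= K by have := le_trans (normr_ge0 _) (hc 0%N); rewrite expr1n invr1 mulr1.
have step k : `|c k.+1 - c k| <= 2 * K * (harmonic k - harmonic k.+1).
  apply: le_trans (hc k) _; rewrite /harmonic /=.
  have k1 : 0 < k.+1%:R :> R by [].
  have -> : k.+2%:R = k.+1%:R + 1 :> R by rewrite -natr1.
  set m := k.+1%:R in k1 *.
  have m1 : 1 <= m by rewrite /m ler1n.
  have -> : 2 * K * (m^-1 - (m + 1)^-1) = K * m ^- 2 * (2 * m / (m + 1)).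
    by field; rewrite !gt_eqF; lra.
  by rewrite ler_peMr ?divr_ge0 ?sqr_ge0 // ler_pdivlMr; lra.
have inc : {homo (fun k => c k - 2 * K * harmonic k) : n m / (n <= m)%N >-> n <= m}.
  by apply/nondecreasing_seqP => k; have := step k; rewrite ler_norml => /andP[]; lra.
have dec : {homo (fun k => c k + 2 * K * harmonic k) : n m / (n <= m)%N >-> m <= n}.
  by apply/nonincreasing_seqP => k; have := step k; rewrite ler_norml => /andP[]; lra.
have cvh : cvgn (fun k => 2 * K * @harmonic R k).
  by apply: is_cvgZl_tmp; apply/cvg_ex; exists 0; exact: cvg_harmonic.
have cvd : cvgn (fun k => c k + 2 * K * harmonic k).
  apply: nonincreasing_is_cvgn => //; exists (c 0%N - 2 * K * harmonic 0%N).
  move=> _ [k _ <-]; apply: le_trans (inc 0%N k isT) _.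
  have : 0 <= 2 * K * @harmonic R k by rewrite !mulr_ge0 ?harmonic_ge0.
  lra.
have -> : c = (fun k => c k + 2 * K * harmonic k) \- (fun k => 2 * K * harmonic k).
  by apply/funext => k /=; rewrite addrK.
exact: is_cvgB.
Qed.

(* The matrix form of T_{u_1} o ... o T_{u_{n+1}}, normalised by q_n: here
   [x n] = q_{n+1} / q_n and [T n] = p_n / q_n. *)
Lemma compositionE (R : realType) (u x T : nat -> R) :
    x 0%N = 1 -> (forall k, x k != 0) ->
    (forall k, u k.+2 != 0) ->
    (forall k, x k.+1 = 1 - u k.+2 / x k) ->
    T 0%N = 0 -> T 1%N = - u 1%N ->
    (forall k, T k.+2 - T k.+1 = (1 - x k.+1) / x k.+1 * (T k.+1 - T k)) ->
  forall n (z : boundary R),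
    foldr (fun i z => Tmap (u i) z) z (iota 1 n.+1) =
    if z is Some z then
      if x n + z == 0 then None
      else Some ((T n.+1 * x n + T n * z) / (x n + z))
    else Some (T n).
Proof.
move=> x0 xn un xE T0 T1 TE; elim=> [|n IH] z.
  rewrite /= x0 T0 T1; case: z => [z|//] /=.
  by rewrite -addr_eq0 (addrC 1 z) mul0r addr0 mulr1 mulNr.
rewrite -[n.+2]addn1 iotaD foldr_cat IH /= add1n addn1.
(* The recurrence p_{n+2} = p_{n+1} - u_{n+2} p_n, divided by q_{n+1}. *)
have TE' : T n.+2 * x n.+1 = T n.+1 - (1 - x n.+1) * T n.
  by rewrite -(subrK (T n.+1) (T n.+2)) TE; field.
have x1 : x n.+1 = 1 - u n.+2 / x n by exact: xE.
have xz := xn n; have uz := un n.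
case: z => [z|] /=; last by rewrite addr0 mulr0 addr0 mulfK// (negbTE xz).
(* At z = -1 the innermost map gives infinity, where the induction hypothesis has the value
   [T n.+1]. *)
have [->|z1] := eqVneq z (-1).
  have xn1 : x n.+1 - 1 = - (u n.+2 / x n) by rewrite x1; ring.
  rewrite xn1 oppr_eq0 mulf_eq0 invr_eq0 (negbTE uz) (negbTE xz) /=.
  congr Some; rewrite TE' -xn1.
  have : x n.+1 - 1 != 0 by rewrite xn1 oppr_eq0 mulf_neq0 ?invr_eq0.
  by move=> h; field.
have z1' : z + 1 != 0 by rewrite addr_eq0.
have den : x n + - (u n.+2 / (z + 1)) = x n * (x n.+1 + z) / (z + 1).
  by rewrite x1; field; apply/andP.
rewrite den !mulf_eq0 invr_eq0 (negbTE xz) (negbTE z1') orbF /=.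
case: ifPn => // h; congr Some; rewrite TE'.
have -> : u n.+2 = (1 - x n.+1) * x n by rewrite x1; field.
by field; rewrite z1' xz h.
Qed.

(** * The perturbed orbit and its decay estimates *)

(* With e_k^2 = 18/m and m = k + 288, the gain factor 1 + e_k^2/6 = 1 + 3/m is at
   least (1 + 1/m)^2, and 288 = 18 * 16 ensures e_k <= 1/4. *)
Lemma controlled_orbit (R : realType) (a : R) : 1 / 4 < a ->
  exists x t e : nat -> R, x 0%N = 1 /\ forall k,
    [/\ e k ^+ 2 = 18 / (k + 288)%:R, 0 < e k <= 1 / 4, x k != 0,
        x k.+1 = 1 - a / (t k * x k) &
    [/\ `|t k - 1| <= 2 * e k,
        e k ^+ 2 * fixpoly a (x k) / 6 <= (t k - 1) * (x k ^+ 2 - a / t k)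
        & e k / 8 <= `|x k.+1|]].
Proof.
move=> ha.
pose e k : R := Num.sqrt (18 / (k + 288)%:R).
have m288 k : 288 <= (k + 288)%:R :> R by rewrite natrD lerDr.
have e2 k : e k ^+ 2 = 18 / (k + 288)%:R.
  by apply: sqr_sqrtr; apply: divr_ge0; exact: ler0n.
have he k : 0 < e k <= 1 / 4.
  have e0 : 0 < e k by rewrite sqrtr_gt0 divr_gt0 ?ltr0n ?addn_gt0 ?orbT.
  rewrite e0 /= -ler_sqr ?nnegrE ?(ltW e0) ?divr_ge0 // e2.
  by move: (m288 k); move: (k + 288)%:R => m hm; rewrite ler_pdivrMr; lra.
(* The perturbation depends on the current ratio, so one is chosen for every pair of index and ratio
   before the recursion. *)
have /choice[t tP] (p : nat * R) := perturbation_exists p.2 ha (he p.1).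
pose fix x k := if k is j.+1 then 1 - a / (t (j, x j) * x j) else 1.
have t0 k y : t (k, y) != 0.
  have [] := tP (k, y); rewrite /= ler_norml => /andP[h _] _ _.
  by rewrite gt_eqF //; have := he k; lra.
have xS k : x k != 0 -> e k / 8 <= `|x k.+1|.
  move=> xk; have [_ _] := tP (k, x k) => /= h.
  have s0 : t (k, x k) * x k != 0 by rewrite mulf_neq0.
  rewrite -(ler_pM2r (_ : 0 < `|t (k, x k) * x k|)) ?normr_gt0 //.
  by apply: le_trans h _; rewrite -normrM mulrBl mul1r divfK.
have x0 k : x k != 0.
  elim: k => [|k /xS h]; first exact: oner_neq0.
  by rewrite -normr_gt0 (lt_le_trans _ h) //; have := he k; lra.
exists x, (fun k => t (k, x k)), e; split=> // k.
by have [h1 h2 h3] := tP (k, x k); split=> //; split=> //; exact: xS.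
Qed.

(** Each step multiplies the weight by at most (m/(m+1))^2, and these factors telescope from m =
    288. *)
Lemma weight_bound (R : realType) (a : R) (x t e V : nat -> R) : 1 / 4 < a ->
    V 0%N = -1 ->
    (forall k, [/\ V k.+1 = V k * (t k * fixpoly a (x k) / fixpoly a (t k * x k)),
      0 < t k, e k ^+ 2 = 18 / (k + 288)%:R &
      e k ^+ 2 * fixpoly a (x k) / 6 <= (t k - 1) * (x k ^+ 2 - a / t k)]) ->
  forall k, `|V k| <= (288 / (k + 288)%:R) ^+ 2.
Proof.
move=> ha V0 hV; elim=> [|k IH].
  by rewrite V0 normrN1 add0n divff ?pnatr_eq0 ?expr1n.
have [-> t0 e2 gain] := hV k; rewrite addSn -[(k + 288).+1%:R]natr1.
have : 288 <= (k + 288)%:R :> R by rewrite natrD lerDr.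
move: IH e2 gain; move: (k + 288)%:R => m IH -> gain hm.
have f0 := fixpoly_gt0 (x k) ha; have f1 := fixpoly_gt0 (t k * x k) ha.
have ratio : t k * fixpoly a (x k) / fixpoly a (t k * x k) <= (m / (m + 1)) ^+ 2.
  rewrite ler_pdivrMr // expr_div_n mulrAC ler_pdivlMr; last first.
    by rewrite exprn_gt0 //; lra.
  have -> : fixpoly a (t k * x k) = t k * (fixpoly a (x k) +
      (t k - 1) * (x k ^+ 2 - a / t k)).
    by rewrite /fixpoly; field; rewrite gt_eqF.
  rewrite -mulrA [leRHS]mulrCA ler_pM2l //.
  have h : fixpoly a (x k) * (m + 1) ^+ 2 <= m ^+ 2 * (fixpoly a (x k) +
      (18 / m * fixpoly a (x k) / 6)).
    have -> : m ^+ 2 * (fixpoly a (x k) + (18 / m * fixpoly a (x k) / 6)) =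
      fixpoly a (x k) * (m ^+ 2 + 3 * m) by field; rewrite gt_eqF //; lra.
    by rewrite ler_pM2l //; nra.
  by apply: le_trans h _; rewrite ler_wpM2l ?sqr_ge0 // lerD2l.
rewrite normrM (ger0_norm (_ : 0 <= _ / _)); last first.
  by rewrite divr_ge0 ?mulr_ge0 // ltW.
have -> : 288 / (m + 1) = 288 / m * (m / (m + 1)) by field; rewrite !gt_eqF; lra.
by rewrite exprMn ler_pM // divr_ge0 ?mulr_ge0 // ltW.
Qed.

(** From 8/m <= 18/m = e^2 <= e follows |x| >= 1/m; thus a/x grows at most linearly in m, against
    the quadratic decay of v. *)
Lemma approximation_error_bound (R : realFieldType) (N a m e x v : R) :
    0 <= N -> 0 < a -> 18 <= m -> e ^+ 2 = 18 / m -> 0 < e <= 1 / 4 ->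
    e / 8 <= `|x| -> `|v| <= (N / (m + 1)) ^+ 2 ->
  `|v * (1 / 2 - a / x)| <= N ^+ 2 * (1 + a) * m^-1.
Proof.
move=> N0 a0 hm e2 /andP[e0 e1] hx hv.
have m0 : 0 < m by lra.
have xinv : `|a / x| <= a * m.
  rewrite normrM normfV gtr0_norm // ler_pM2l // -[leRHS]invrK.
  rewrite lef_pV2 ?posrE ?invr_gt0 ?(lt_le_trans _ hx) //; last by lra.
  apply: le_trans hx; rewrite ler_pdivlMr //.
  apply: (@le_trans _ _ (e ^+ 2)); last by nra.
  by rewrite e2 mulrC ler_pM2r ?invr_gt0 //; lra.
have -> : N ^+ 2 * (1 + a) / m = (N / m) ^+ 2 * ((1 + a) * m).
  by field; rewrite gt_eqF.
rewrite normrM; apply: ler_pM => //.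
  apply: le_trans hv _; rewrite !exprMn ler_wpM2l ?sqr_ge0 //.
  by rewrite ler_sqr ?nnegrE ?invr_ge0 ?lef_pV2 ?posrE //; lra.
apply: le_trans (ler_normB _ _) _; rewrite ger0_norm; last by lra.
nra.
Qed.

(** * Convergence of the perturbed continued fraction *)

Theorem theorem1p1 (R : realType) (a : R) (ha : 1 / 4 < a) :
  exists u : nat -> R,
    [/\ forall i : nat, (1 <= i)%N -> u i != 0,
        u i @[i --> \oo] --> a
      & cfrac_converges u].
Proof.
have [x [t [e [x0 orbit]]]] := controlled_orbit ha.
have a0 : a != 0 by rewrite gt_eqF; lra.
have tn k : `|t k - 1| <= 1 / 2.
  by have [_ e1 _ _ [h _ _]] := orbit k; lra.
have t0 k : 0 < t k by have := tn k; rewrite ler_norml; lra.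
have xn k : x k != 0 by have [] := orbit k.
have xE k : x k.+1 = 1 - a / (t k * x k) by have [] := orbit k.
have m288 k : 288 <= (k + 288)%:R :> R by rewrite natrD lerDr.
have harm k : (k + 288)%:R^-1 <= harmonic k :> R.
  by rewrite /harmonic lef_pV2 ?posrE ?ltr0n ?addn_gt0 ?orbT // ler_nat -addn1 leq_add2l.
(* [t k] perturbs the coefficient of index k + 2, which takes [x k] to [x k.+1]. For n = k + 1,
   [x k] is r_n, [T n] is tau_n, [D k] is tau_n - tau_{n-1}, and [V k], [c k] are V_n, c_n. *)
pose u (n : nat) : R := if n is k.+2 then a / t k else a.
pose D (k : nat) : R := - a * \prod_(i < k) ((1 - x i.+1) / x i.+1).
pose T (n : nat) : R := \sum_(k < n) D k.
have DS k : D k.+1 = (1 - x k.+1) / x k.+1 * D k.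
  by rewrite /D big_ord_recr /=; ring.
have TS k : T k.+1 = T k + D k by rewrite /T big_ord_recr.
have TD k : T k.+1 - T k = D k by rewrite TS addrC addKr.
pose V (k : nat) : R := x k * D k / fixpoly a (x k).
have V0 : V 0%N = -1.
  by rewrite /V /D x0 big_ord0 /fixpoly; field.
have x1 k : 1 - a / (t k * x k) != 0 by rewrite -xE.
have VS k : V k.+1 = V k * (t k * fixpoly a (x k) / fixpoly a (t k * x k)).
  rewrite /V DS xE; exact: (weight_step _ ha (lt0r_neq0 (t0 k)) (xn k) (x1 k)).
have [N N0 Vle] : exists2 N : R, 0 < N & forall k, `|V k| <= (N / (k + 288)%:R) ^+ 2.
  exists 288; first by rewrite ltr0n.
  by apply: (@weight_bound _ a x t e V) => // k; have [? ? ? ? []] := orbit k.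
pose c (k : nat) : R := T k.+1 + D k * (x k / 2 - a) / fixpoly a (x k).
have cS k : c k.+1 - c k = V k * (t k - 1) *
    (a * (t k * x k + x k) - t k * x k * x k / 2 - a / 2) / fixpoly a (t k * x k).
  rewrite -(center_step _ ha (lt0r_neq0 (t0 k)) (xn k) (x1 k)) -xE -DS /c (TS k.+1).
  ring.
have cTE k : c k - T k.+1 = V k * (1 / 2 - a / x k).
  rewrite /c /V; have := lt0r_neq0 (fixpoly_gt0 (x k) ha) => f0.
  by field; rewrite f0 xn.
have [C C0 hC] := center_step_bound ha.
have cvc : cvgn c.
  apply: (@cvg_of_increments_le _ _ (N ^+ 2 * C)) => k.
  rewrite cS -mulrA normrM [leRHS]mulrAC ler_pM //; last exact: hC.
    have t1 := tn k; rewrite normrM -[leRHS]mulr1 ler_pM //.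
      apply: le_trans (Vle k) _.
      rewrite exprMn; apply: ler_wpM2l; first exact: sqr_ge0.
      rewrite -exprVn.
      apply: ler_pM; rewrite ?invr_ge0 ?ler0n //; exact: harm.
    lra.
have cT : c k - T k.+1 @[k --> \oo] --> (0 : R).
  (* Stage k of the orbit bounds [x k.+1] from below, hence the shifted index. *)
  have bound k : `|c k.+1 - T k.+2| <= N ^+ 2 * (1 + a) * harmonic k.
    apply: le_trans (_ : N ^+ 2 * (1 + a) * (k + 288)%:R^-1 <= _); last first.
      by rewrite ler_wpM2l ?harm // mulr_ge0 ?sqr_ge0 //; lra.
    have [e2 e1 _ _ [_ _ xge]] := orbit k.
    rewrite cTE; apply: approximation_error_bound e2 e1 xge _.
    - exact: ltW.
    - by lra.
    - by apply: le_trans (m288 k); rewrite ler_nat.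
    - by rewrite natr1 -addSn.
  have hb : N ^+ 2 * (1 + a) * harmonic k @[k --> \oo] --> (0 : R).
    by rewrite -[X in _ --> X](mulr0 (N ^+ 2 * (1 + a)));
      apply: cvgMl_tmp; exact: cvg_harmonic.
  rewrite -cvg_shiftS; apply: (@squeeze_cvgr _ _ _ _
      (fun k => - (N ^+ 2 * (1 + a) * harmonic k))
      (fun k => N ^+ 2 * (1 + a) * harmonic k)).
  - by apply: nearW => k; rewrite -ler_norml; exact: bound.
  - by rewrite -[X in _ --> X]oppr0; exact: cvgN.
  - exact: hb.
have cvT : T k.+1 @[k --> \oo] --> limn c.
  have -> : (fun k => T k.+1) = c \- (fun k => c k - T k.+1).
    by apply/funext => k /=; rewrite subKr.
  by rewrite -[X in _ --> X]subr0; exact: (cvgB cvc cT).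
have cvt : t k @[k --> \oo] --> (1 : R).
  have cve2 : e k ^+ 2 @[k --> \oo] --> (0 : R).
    apply: (@squeeze_cvgr _ _ _ _ (fun=> 0) (fun k => 18 * harmonic k)).
    - apply: nearW => k; have [-> _ _ _ _] := orbit k.
      apply/andP; split; first by apply: divr_ge0; exact: ler0n.
      by apply: ler_wpM2l; [exact: ler0n|exact: harm].
    - exact: cvg_cst.
    - by rewrite -[X in _ --> X](mulr0 18); apply: cvgMl_tmp; exact: cvg_harmonic.
  have cve : e k @[k --> \oo] --> (0 : R).
    have -> : e = Num.sqrt \o (fun k => e k ^+ 2).
      apply/funext => k; have [_ /andP[e0 _] _ _ _] := orbit k.
      by rewrite /= sqrtr_sqr gtr0_norm.
    rewrite -sqrtr0; apply: cvg_comp cve2 _; exact: sqrt_continuous.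
  apply: (@squeeze_cvgr _ _ _ _ (fun k => 1 - 2 * e k) (fun k => 1 + 2 * e k)).
  - apply: nearW => k; have [_ _ _ _ [h _ _]] := orbit k.
    by move: h; rewrite ler_norml; lra.
  - by rewrite -[X in _ --> X]subr0 -[X in _ --> _ - X](mulr0 2);
      apply: cvgB; [exact: cvg_cst|exact: cvgMl_tmp].
  - by rewrite -[X in _ --> X]addr0 -[X in _ --> _ + X](mulr0 2);
      apply: cvgD; [exact: cvg_cst|exact: cvgMl_tmp].
exists u; split.
- by case=> [|[|k]] // _; rewrite /u // mulf_neq0 // invr_neq0 // gt_eqF.
- rewrite -2!cvg_shiftS.
  have : a / t k @[k --> \oo] --> a / 1 by apply: cvgM; [exact: cvg_cst|exact: cvgV].
  by rewrite divr1.
exists (Some (limn c)); rewrite -cvg_shiftS /=.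
(* At z = 0 the composition formula has denominator [x n], which is nonzero, so these approximants
   are finite. *)
have uE n : approximant u n.+1 = Some (T n.+1).
  rewrite /approximant (@compositionE _ u x T) //.
  - by rewrite addr0 (negbTE (xn n)) mulr0 addr0 mulfK.
  - by move=> k; rewrite /u mulf_neq0 // invr_neq0 // gt_eqF.
  - by move=> k; rewrite xE /u invfM mulrA.
  - by rewrite /T big_ord0.
  - by rewrite /T big_ord1 /D big_ord0 mulr1.
  - by move=> k; rewrite !TD DS.
under eq_fun do rewrite uE.
apply: (@cvg_comp _ _ _ (fun n => T n.+1) Some).
  exact: cvT.
exact: one_point_compactification_some_continuous.
Qed.
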